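(* Let $\lambda$ be an infinite cardinal and $\chi\le\operatorname{cf}(\lambda)$ a cardinal, and suppose that $E^{\lambda^+}_{\ge\chi}$ contains a non-reflecting stationary subset. Then for every coloring $c:[\lambda^+]^2\to\lambda$ there exists a coloring $c^+:[\lambda^+]^2\to\lambda^+$ such that for every cardinal $\mu\le\lambda$ and every partition $p:[\lambda^+]^2\to\mu$: (1) if $c$ witnesses $\mathrm{pr}_1(\lambda^+,\lambda^+,\lambda,\chi)_p$ then $c^+$ witnesses $\mathrm{pr}_1(\lambda^+,\lambda^+,\lambda^+,\chi)_p$; (2) if $c$ witnesses $\mathrm{pr}_1(\lambda^+,\lambda^+\circledast\lambda^+,\lambda,\chi)_p$ then $c^+$ witnesses $\mathrm{pr}_1(\lambda^+,\lambda^+\circledast\lambda^+,\lambda^+,\chi)_p$.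
   Context: $E^{\lambda^+}_{\ge\chi}=\{\alpha<\lambda^+\mid\operatorname{cf}(\alpha)\ge\chi\}$. A stationary set $S\subseteq\lambda^+$ is non-reflecting iff for no $\alpha<\lambda^+$ of uncountable cofinality is $S\cap\alpha$ stationary in $\alpha$. $[\kappa]^2$ denotes the set of pairs $(\alpha,\beta)$ with $\alpha<\beta<\kappa$; a partition is any function $p:[\kappa]^2\to\mu$. For an ordinal $\sigma$, $[\kappa]^\sigma$ is the set of subsets of $\kappa$ of order type $\sigma$; $a<b$ means every element of $a$ is below every element of $b$. Given $p:[\kappa]^2\to\mu$, a coloring $c:[\kappa]^2\to\theta$ witnesses $\mathrm{pr}_1(\kappa,\kappa,\theta,\chi)_p$ iff for every ordinal $\sigma<\chi$, every pairwise disjoint $\mathcal A\subseteq[\kappa]^\sigma$ of size $\kappa$ and every $\tau:\mu\to\theta$ there are $a,b\in\mathcal A$, $a<b$, with $c(\alpha,\beta)=\tau(p(\alpha,\beta))$ for all $\alpha\in a,\beta\in b$. It witnesses $\mathrm{pr}_1(\kappa,\kappa\circledast\kappa,\theta,\chi)_p$ iff for every ordinal $\sigma<\chi$ and every two families $\mathcal A,\mathcal B\subseteq[\kappa]^\sigma$, each pairwise disjoint and of size $\kappa$, there is $\mathcal A'\subseteq\mathcal A$ of size $\kappa$ such that for every $\tau:\mu\to\theta$ there are $a\in\mathcal A'$, $b\in\mathcal B$, $a<b$, with $c(\alpha,\beta)=\tau(p(\alpha,\beta))$ for all $\alpha\in a,\beta\in b$. *)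

(* Defs.v *)
(* Ordinals are represented by elements of well-ordered types:
   a cardinal kappa is represented by a type carrying a well-order of order
   type kappa (the initial ordinal); ordinals below kappa are its elements. *)
From Stdlib Require Import Classical FunctionalExtensionality PropExtensionality.

Definition injective {A B : Type} (f : A -> B) : Prop :=
  forall x y, f x = f y -> x = y.

Definition well_order {T : Type} (lt : T -> T -> Prop) : Prop :=
  well_founded lt /\
  (forall x y z, lt x y -> lt y z -> lt x z) /\
  (forall x y, lt x y \/ x = y \/ lt y x).

Definition le_of {T : Type} (lt : T -> T -> Prop) (x y : T) : Prop :=
  lt x y \/ x = y.

Definition is_cardinal {T : Type} (lt : T -> T -> Prop) : Prop :=
  forall x : T, ~ exists f : T -> {y : T | lt y x}, injective f.

Definition infinite (T : Type) : Prop := exists f : nat -> T, injective f.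

(* the well-order (K, ltK) has order type lambda^+ where lambda = |L|:
   K does not inject into L, every proper initial segment of K does *)
Definition is_successor_of (L : Type) {K : Type} (ltK : K -> K -> Prop) : Prop :=
  (~ exists f : K -> L, injective f) /\
  (forall x : K, exists f : {y : K | ltK y x} -> L, injective f).

Definition cofinal_in {T : Type} (lt : T -> T -> Prop) (D X : T -> Prop) : Prop :=
  (forall y, X y -> D y) /\ (forall x, D x -> exists y, X y /\ le_of lt x y).

Definition cof_ge (C : Type) {T : Type} (lt : T -> T -> Prop) (D : T -> Prop) : Prop :=
  forall X, cofinal_in lt D X -> exists f : C -> {y : T | X y}, injective f.

Definition uncountable_cof {T : Type} (lt : T -> T -> Prop) (D : T -> Prop) : Prop :=
  forall X, cofinal_in lt D X -> ~ exists f : {y : T | X y} -> nat, injective f.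

Definition seg {T : Type} (lt : T -> T -> Prop) (a : T) : T -> Prop := fun y => lt y a.

Definition club_in {T : Type} (lt : T -> T -> Prop) (D Cl : T -> Prop) : Prop :=
  cofinal_in lt D Cl /\
  (forall b, D b -> (exists d, lt d b) ->
     (forall d, lt d b -> exists g, Cl g /\ lt d g /\ lt g b) -> Cl b).

Definition stationary_in {T : Type} (lt : T -> T -> Prop) (D S : T -> Prop) : Prop :=
  forall Cl, club_in lt D Cl -> exists x, D x /\ S x /\ Cl x.

Definition nonreflecting_stationary_in_E (C : Type) {K : Type}
    (ltK : K -> K -> Prop) (S : K -> Prop) : Prop :=
  (forall a, S a -> cof_ge C ltK (seg ltK a)) /\
  stationary_in ltK (fun _ => True) S /\
  (forall a, uncountable_cof ltK (seg ltK a) -> ~ stationary_in ltK (seg ltK a) S).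

Section Pr1.
Variables (K : Type) (ltK : K -> K -> Prop) (C : Type) (ltC : C -> C -> Prop).

(* the set a has order type the ordinal s < chi (s an element of C) *)
Definition has_otp (s : C) (a : K -> Prop) : Prop :=
  exists f : {xi : C | ltC xi s} -> K,
    (forall xi, a (f xi)) /\
    (forall xi1 xi2, ltC (proj1_sig xi1) (proj1_sig xi2) -> ltK (f xi1) (f xi2)) /\
    (forall x, a x -> exists xi, f xi = x).

Definition size_K (A : (K -> Prop) -> Prop) : Prop :=
  (exists f : K -> {a : K -> Prop | A a}, injective f) /\
  (exists g : {a : K -> Prop | A a} -> K, injective g).

Definition good_family (s : C) (A : (K -> Prop) -> Prop) : Prop :=
  (forall a, A a -> has_otp s a) /\
  (forall a b, A a -> A b -> a <> b -> forall x, ~ (a x /\ b x)) /\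
  size_K A.

Definition set_lt (a b : K -> Prop) : Prop := forall x y, a x -> b y -> ltK x y.

(* c witnesses pr_1(kappa, kappa, theta, chi)_p, with kappa = |K|, theta = |Th|,
   chi = |C|, mu = |M| *)
Definition pr1 (Th : Type) (c : K -> K -> Th) (M : Type) (p : K -> K -> M) : Prop :=
  forall (s : C) (A : (K -> Prop) -> Prop), good_family s A ->
  forall tau : M -> Th, exists a b, A a /\ A b /\ set_lt a b /\
    (forall x y, a x -> b y -> c x y = tau (p x y)).

Definition pr1_circ (Th : Type) (c : K -> K -> Th) (M : Type) (p : K -> K -> M) : Prop :=
  forall (s : C) (A B : (K -> Prop) -> Prop), good_family s A -> good_family s B ->
  exists A' : (K -> Prop) -> Prop, (forall a, A' a -> A a) /\ size_K A' /\
  forall tau : M -> Th, exists a b, A' a /\ B b /\ set_lt a b /\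
    (forall x y, a x -> b y -> c x y = tau (p x y)).

End Pr1.

(* Main.v *)
(* Write e_w for an injection of the ordinals up to w into lambda, and view each
   colour of c as a triple (xi, zeta, eta) of ordinals below lambda. The colour
   c+(alpha, beta) is the x with e_w(x) = xi, where w is given by
   e_g(w) = zeta and g is the first point with h(g) >= eta on the walk from beta
   to alpha; here h : lambda^+ -> lambda takes values >= eta on a stationary
   subset of S for every eta. The walks follow ladders which are bounded below
   every point of S, so that a walk from above d in S to a point close enough
   to d passes through d.

   Given tau, fix w bounding its values; then tau is coded by e_w o tau, with
   values below lambda. For stationarily many d0 in S choose a set b of the
   family above d0. As |b| < chi is below cf(d0) and cf(lambda), the walks from
   all points of b to alpha below and near d0 pass through d0 and h stays below
   some eta on the way; by pressing down the bounds do not depend on d0. For d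
   in S with h(d) >= eta and such a d0 above d, all these walks have a common
   first point g with h(g) >= eta, and it is not below d. Pressing down once
   more fixes zeta = e_g(w). In (2) the subfamily A' can be taken to be A, since
   the required property is monotone in A'. *)
From Stdlib Require Import Classical ClassicalEpsilon FunctionalExtensionality
  PropExtensionality.
From Stdlib Require Import Wellfounded Relation_Operators Cantor Lia.
Require Import Defs.

(** * Well-orders and injections by transfinite recursion *)

Definition inj_on {A B : Type} (X : A -> Prop) (f : A -> B) : Prop :=
  forall x y, X x -> X y -> f x = f y -> x = y.

Definition down_closed {T : Type} (lt : T -> T -> Prop) (U : T -> Prop) : Prop :=
  forall x y, U x -> lt y x -> U y.

Lemma le_of_dec {T} (lt : T -> T -> Prop) (H : well_order lt) x y :
  lt x y \/ le_of lt y x.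
Proof. destruct H as [_ [_ H]]. unfold le_of. destruct (H x y) as [|[|]]; auto. Qed.

Lemma le_of_refl {T} (lt : T -> T -> Prop) x : le_of lt x x.
Proof. right; reflexivity. Qed.

Lemma lt_irr {T} (lt : T -> T -> Prop) (H : well_order lt) x : ~ lt x x.
Proof.
  destruct H as [W _]. induction (W x) as [x _ IH]. intros Hx. exact (IH x Hx Hx).
Qed.

Lemma lt_le_trans {T} (lt : T -> T -> Prop) (H : well_order lt) x y z :
  lt x y -> le_of lt y z -> lt x z.
Proof. destruct H as [_ [H _]]. intros ? [?|<-]; eauto. Qed.

Lemma le_lt_trans {T} (lt : T -> T -> Prop) (H : well_order lt) x y z :
  le_of lt x y -> lt y z -> lt x z.
Proof. destruct H as [_ [H _]]. intros [?|<-] ?; eauto. Qed.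

Lemma le_le_trans {T} (lt : T -> T -> Prop) (H : well_order lt) x y z :
  le_of lt x y -> le_of lt y z -> le_of lt x z.
Proof. intros ? [?|<-]; auto. left; eapply le_lt_trans; eauto. Qed.

Lemma le_not_lt {T} (lt : T -> T -> Prop) (H : well_order lt) x y :
  le_of lt x y -> ~ lt y x.
Proof. intros H1 H2. apply (lt_irr lt H y). eapply lt_le_trans; eauto. Qed.

Lemma least_element {T} (lt : T -> T -> Prop) (H : well_order lt) (X : T -> Prop) :
  (exists x, X x) -> exists x, X x /\ forall y, X y -> le_of lt x y.
Proof.
  destruct H as [W [_ Tot]]. intros [x Hx]. revert Hx.
  induction (W x) as [x _ IH]. intros Hx.
  destruct (classic (exists y, X y /\ lt y x)) as [[y [Hy Hyx]]|N].
  - eauto.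
  - exists x; split; auto. intros y Hy. unfold le_of.
    destruct (Tot x y) as [|[|]]; auto. exfalso; eauto.
Qed.

Lemma upper_bound2 {T} (lt : T -> T -> Prop) (H : well_order lt) x y :
  exists z, (z = x \/ z = y) /\ le_of lt x z /\ le_of lt y z.
Proof.
  destruct (le_of_dec lt H x y).
  - exists y; repeat split; auto. left; auto. apply le_of_refl.
  - exists x; repeat split; auto. apply le_of_refl.
Qed.

Lemma greedy_injection {W T} (R : W -> W -> Prop) (V : W -> Prop) (Y : T -> Prop) :
  well_founded R -> (forall x y, R x y \/ x = y \/ R y x) -> inhabited T ->
  (forall w, V w -> forall g : W -> T,
     exists t, Y t /\ forall v, V v -> R v w -> g v <> t) ->
  exists f : W -> T, (forall w, V w -> Y (f w)) /\ inj_on V f.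
Proof.
  intros Wf Tot IT H.
  set (F := fun (w : W) (rec : forall v, R v w -> T) =>
    epsilon IT (fun t => Y t /\ forall v (r : R v w), V v -> rec v r <> t)).
  set (f := Fix Wf (fun _ => T) F).
  assert (E : forall w, f w = F w (fun v _ => f v)).
  { intros w. unfold f. rewrite Fix_eq; auto.
    intros x g1 g2 Hg. f_equal. extensionality v. extensionality r. apply Hg. }
  assert (Sp : forall w, V w -> Y (f w) /\ forall v, R v w -> V v -> f v <> f w).
  { intros w Vw. rewrite (E w). unfold F.
    apply (epsilon_spec IT (fun t => Y t /\ forall v, R v w -> V v -> f v <> t)).
    destruct (H w Vw f) as [t [Yt Ht]]. exists t; auto. }
  exists f. split.
  - intros w Vw. apply (Sp w Vw).
  - intros x y Vx Vy Exy. destruct (Tot x y) as [Rxy|[|Ryx]]; auto.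
    + destruct (proj2 (Sp y Vy) x Rxy Vx Exy).
    + destruct (proj2 (Sp x Vx) y Ryx Vy (eq_sym Exy)).
Qed.

(** * Cardinal arithmetic: the square of an infinite well-ordered set *)

Section Squares.
Variables (T : Type) (lt : T -> T -> Prop).
Hypothesis wo : well_order lt.

(* Adding a copy of [nat] makes the cardinal arithmetic below uniform: the
   induction needs neither a case for finite sets nor an absorption lemma. *)
Definition with_nat (U : T -> Prop) (z : nat + T) : Prop :=
  match z with inl _ => True | inr x => U x end.

Definition squares_into (U : T -> Prop) : Prop :=
  exists f : (nat + T) * (nat + T) -> nat + T,
    (forall a b, with_nat U a -> with_nat U b -> with_nat U (f (a, b))) /\
    (forall a b a' b', with_nat U a -> with_nat U b -> with_nat U a' ->
       with_nat U b' -> f (a, b) = f (a', b') -> a = a' /\ b = b').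

Let ltS := le_AsB nat T Peano.lt lt.

Lemma ltS_well_order : well_order ltS.
Proof.
  destruct wo as [W [Tr Tot]]. split; [|split].
  - apply wf_disjoint_sum; auto. apply Wf_nat.lt_wf.
  - intros x y z Hxy Hyz.
    inversion Hxy; subst; inversion Hyz; subst; constructor; eauto; lia.
  - intros [n|x] [m|y].
    + destruct (PeanoNat.Nat.lt_trichotomy n m) as [|[|]]; subst;
        [left|right;left|right;right]; auto; constructor; auto.
    + left; constructor.
    + right; right; constructor.
    + destruct (Tot x y) as [|[|]]; subst;
        [left|right;left|right;right]; auto; constructor; auto.
Qed.

Let mx (w : (nat + T) * (nat + T)) : nat + T :=
  if excluded_middle_informative (ltS (fst w) (snd w)) then snd w else fst w.

(** Gödel's well-order of pairs, by maximum and then lexicographically: the predecessors of [w] lie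
    in the square of the closed segment up to [mx w]. *)
Let R v w := slexprod _ _ ltS (slexprod _ _ ltS ltS) (mx v, v) (mx w, w).

Lemma mx_spec w : (mx w = fst w \/ mx w = snd w) /\
  le_of ltS (fst w) (mx w) /\ le_of ltS (snd w) (mx w).
Proof.
  unfold mx. destruct (excluded_middle_informative _) as [l|l].
  - repeat split; auto. left; auto. right; auto.
  - repeat split; auto. right; auto.
    destruct (le_of_dec ltS ltS_well_order (fst w) (snd w)); auto. contradiction.
Qed.

Lemma R_wf : well_founded R.
Proof.
  unfold R. apply (wf_inverse_image _ _ _ (fun w => (mx w, w))).
  destruct ltS_well_order as [W _]. repeat apply wf_slexprod; auto.
Qed.

Lemma slexprod_total {A B} (ltA : A -> A -> Prop) (ltB : B -> B -> Prop) :
  (forall x y, ltA x y \/ x = y \/ ltA y x) ->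
  (forall x y, ltB x y \/ x = y \/ ltB y x) ->
  forall x y, slexprod A B ltA ltB x y \/ x = y \/ slexprod A B ltA ltB y x.
Proof.
  intros HA HB [a b] [a' b'].
  destruct (HA a a') as [|[<-|]];
    [left; constructor; auto | | right; right; constructor; auto].
  destruct (HB b b') as [|[<-|]]; auto;
    [left | right; right]; apply right_slex; auto.
Qed.

Lemma R_total v w : R v w \/ v = w \/ R w v.
Proof.
  destruct ltS_well_order as [_ [_ Tot]].
  destruct (slexprod_total _ _ Tot (slexprod_total _ _ Tot Tot) (mx v, v) (mx w, w))
    as [|[E|]]; auto.
  inversion E; auto.
Qed.

Lemma R_le v w : R v w -> le_of ltS (fst v) (mx w) /\ le_of ltS (snd v) (mx w).
Proof.
  intros H. assert (M : le_of ltS (mx v) (mx w)).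
  { inversion H; subst; [left; auto | right; auto]. }
  destruct (mx_spec v) as [_ [H1 H2]].
  split; eapply le_le_trans; eauto; apply ltS_well_order.
Qed.

(** Hilbert's hotel: the naturals shift by one and [x] takes the free place, which turns the closed
    segment up to [x] into the open one. *)
Let absorb (x : T) (z : nat + T) : nat + T :=
  match z with
  | inl n => inl (S n)
  | inr y => if excluded_middle_informative (y = x) then inl 0 else inr y
  end.

Lemma absorb_spec x z : le_of ltS z (inr x) -> with_nat (seg lt x) (absorb x z).
Proof.
  destruct z as [n|y]; simpl; auto. intros H.
  destruct (excluded_middle_informative _); simpl; auto.
  destruct H as [H|H]; inversion H; auto. subst; contradiction.
Qed.

Lemma absorb_inj x z z' : absorb x z = absorb x z' -> z = z'.
Proof.
  destruct z, z'; simpl; repeat destruct (excluded_middle_informative _);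
    intros E; inversion E; subst; auto.
Qed.

(** If [nat + U] injects into [nat] plus a proper segment, its square passes through the square of
    that segment. Otherwise the greedy injection along [R] never gets stuck: being stuck at [w]
    would inject [nat + U] into the predecessors of [w], hence by the induction hypothesis into
    [nat] plus a proper segment. *)
Lemma squares_into_step U :
  down_closed lt U -> (forall x, U x -> squares_into (seg lt x)) -> squares_into U.
Proof.
  intros DU IH.
  destruct (classic (exists x, U x)) as [[x0 Ux0]|NU].
  2:{ exists (fun w => match w with (inl n, inl m) => inl (to_nat (n, m)) | _ => inl 0 end).
      split.
      - intros [] []; simpl; auto.
      - intros [n|a] [m|b] [n'|a'] [m'|b']; simpl; intros; try (exfalso; eauto; fail).
        match goal with H : inl _ = inl _ |- _ => injection H as E end.
        apply (to_nat_inj (n, m) (n', m')) in E. inversion E; auto. }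
  destruct (classic (exists x (g : nat + T -> nat + T), U x /\
     (forall z, with_nat U z -> with_nat (seg lt x) (g z)) /\ inj_on (with_nat U) g))
    as [[x [g [Ux [Hg Ig]]]]|Big].
  { destruct (IH x Ux) as [f [Hf If]].
    exists (fun w => f (g (fst w), g (snd w))). simpl. split.
    - intros a b Ha Hb. specialize (Hf _ _ (Hg a Ha) (Hg b Hb)).
      destruct (f (g a, g b)); simpl in *; auto. eapply DU; eauto.
    - intros a b a' b' Ha Hb Ha' Hb' E. apply If in E; auto.
      destruct E; split; apply Ig; auto. }
  destruct (greedy_injection R (fun w => with_nat U (fst w) /\ with_nat U (snd w))
    (with_nat U) R_wf R_total (inhabits (inl 0))) as [f [Hf If]].
  2:{ exists f; split.
      - intros a b Ha Hb. apply (Hf (a, b)); auto.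
      - intros a b a' b' Ha Hb Ha' Hb' E.
        apply If in E; simpl; auto. inversion E; auto. }
  intros w [Uw1 Uw2] g. apply NNPP. intros N.
  assert (Hk : exists k : nat + T -> (nat + T) * (nat + T),
    forall t, with_nat U t -> R (k t) w /\ g (k t) = t).
  { apply (choice (fun t v => with_nat U t -> R v w /\ g v = t)). intros t.
    apply NNPP. intros N'. apply N. exists t. split.
    - apply NNPP. intros Ut. apply N'. exists w. tauto.
    - intros v _ Rv E. apply N'. exists v; auto. }
  destruct Hk as [k Hk].
  assert (Ik : inj_on (with_nat U) k).
  { intros x y Ux Uy E. rewrite <- (proj2 (Hk x Ux)), <- (proj2 (Hk y Uy)), E. auto. }
  assert (Umx : with_nat U (mx w)).
  { destruct (mx_spec w) as [[->| ->] _]; auto. }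
  apply Big. destruct (mx w) as [n|x] eqn:Em.
  (* Below a natural maximum there are only pairs of naturals; Cantor pairing lands in [nat], so any
     [x0] in [U] serves as the segment. *)
  - assert (K1 : forall t, with_nat U t -> exists p q, k t = (inl p, inl q)).
    { intros t Ut. destruct (R_le _ _ (proj1 (Hk t Ut))) as [H1 H2].
      rewrite Em in *. destruct (k t) as [[p|p] [q|q]]; simpl in *; eauto;
      exfalso; repeat match goal with H : le_of _ _ _ |- _ => destruct H as [H|H] end;
        try discriminate;
        match goal with H : ltS (inr _) (inl _) |- _ => inversion H end. }
    exists x0, (fun t => match k t with (inl p, inl q) => inl (to_nat (p, q)) | _ => inl 0 end).
    repeat split; auto.
    + intros t Ut. destruct (K1 t Ut) as [p [q ->]]. simpl; auto.
    + intros t t' Ut Ut' E. apply Ik; auto.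
      destruct (K1 t Ut) as [p [q E1]]. destruct (K1 t' Ut') as [p' [q' E2]].
      rewrite E1, E2 in *. injection E as E3.
      apply (to_nat_inj (p, q) (p', q')) in E3. congruence.
  - destruct (IH x Umx) as [f [Hf If]].
    assert (K1 : forall t, with_nat U t -> with_nat (seg lt x) (absorb x (fst (k t))) /\
        with_nat (seg lt x) (absorb x (snd (k t)))).
    { intros t Ut. destruct (R_le _ _ (proj1 (Hk t Ut))) as [H1 H2].
      rewrite Em in *. split; apply absorb_spec; auto. }
    exists x, (fun t => f (absorb x (fst (k t)), absorb x (snd (k t)))).
    repeat split; auto.
    + intros t Ut. destruct (K1 t Ut). auto.
    + intros t t' Ut Ut' E. apply Ik; auto.
      destruct (K1 t Ut), (K1 t' Ut'). apply If in E; auto.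
      destruct E as [E1 E2]. apply absorb_inj in E1, E2.
      destruct (k t), (k t'); simpl in *; congruence.
Qed.

Lemma squares_into_full : squares_into (fun _ => True).
Proof.
  assert (D : forall x, down_closed lt (seg lt x)).
  { intros x y z. unfold seg. destruct wo as [_ [Tr _]]. eauto. }
  apply squares_into_step. { intros ? ?; auto. }
  intros x _. destruct wo as [W [Tr _]]. induction (W x) as [x _ IH].
  apply squares_into_step; auto.
Qed.

(** The added naturals go to the even places of a copy of [nat] inside [T], and the old points of
    that copy to the odd places. *)
Lemma infinite_absorbs_nat : infinite T -> exists f : nat + T -> T, injective f.
Proof.
  intros [f If].
  exists (fun z => match z with
    | inl n => f (2 * n)
    | inr x => match excluded_middle_informative (exists m, f m = x) with
               | left H => f (2 * epsilon (inhabits 0) (fun m => f m = x) + 1)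
               | right _ => x end end).
  assert (Sp : forall x, (exists m, f m = x) ->
     f (epsilon (inhabits 0) (fun m => f m = x)) = x).
  { intros x H. exact (epsilon_spec (inhabits 0) (fun m => f m = x) H). }
  intros [n|x] [m|y]; try destruct (excluded_middle_informative _) as [Hx|Hx];
    try destruct (excluded_middle_informative _) as [Hy|Hy]; intros E;
    try (exfalso; eauto; fail); subst; auto;
    try (apply If in E; try lia; f_equal; lia).
  apply If in E. f_equal. rewrite <- (Sp _ Hx), <- (Sp _ Hy). f_equal. lia.
Qed.

Theorem infinite_square : infinite T -> exists f : T * T -> T, injective f.
Proof.
  intros I. destruct (infinite_absorbs_nat I) as [j Ij].
  destruct squares_into_full as [f [_ If]].
  exists (fun w => j (f (inr (fst w), inr (snd w)))).
  intros [a b] [a' b'] E. simpl in E. apply Ij, If in E; simpl; auto.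
  destruct E; congruence.
Qed.

End Squares.

(** * Sets of size at most lambda and the regularity of lambda^+ *)

Section SuccessorCardinal.
Variables (L : Type) (ltL : L -> L -> Prop) (K : Type) (ltK : K -> K -> Prop).
Hypotheses (hL : well_order ltL) (hLcard : is_cardinal ltL) (hLinf : infinite L).
Hypotheses (hK : well_order ltK) (hKsucc : is_successor_of L ltK).

(** Cardinality at most lambda. A total function injective on [X] avoids subset types. *)
Definition small {I : Type} (X : I -> Prop) : Prop :=
  exists f : I -> L, inj_on X f.

Lemma L_inhabited : inhabited L.
Proof. destruct hLinf as [f _]. exact (inhabits (f 0)). Qed.

Lemma small_subset {I} (X Y : I -> Prop) :
  (forall i, X i -> Y i) -> small Y -> small X.
Proof. intros H [f Hf]. exists f. intros x y Hx Hy. apply Hf; auto. Qed.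

Lemma small_preimage {I J} (X : I -> Prop) (Y : J -> Prop) (g : I -> J) :
  (forall i, X i -> Y (g i)) -> inj_on X g -> small Y -> small X.
Proof.
  intros H Hg [f Hf]. exists (fun i => f (g i)). intros x y Hx Hy E.
  apply Hg, Hf; auto.
Qed.

Lemma small_pair {I J} (X : I -> Prop) (Y : J -> Prop) :
  small X -> small Y -> small (fun z => X (fst z) /\ Y (snd z)).
Proof.
  intros [f Hf] [g Hg]. destruct (infinite_square L ltL hL hLinf) as [q Hq].
  exists (fun z => q (f (fst z), g (snd z))).
  intros [a b] [a' b'] [Ha Hb] [Ha' Hb'] E. simpl in *.
  apply Hq in E. injection E as E1 E2. f_equal; auto.
Qed.

Lemma small_L : small (fun _ : L => True).
Proof. exists (fun x => x). intros x y _ _ E; exact E. Qed.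

Lemma K_not_small : ~ small (fun _ : K => True).
Proof.
  intros [f Hf]. apply (proj1 hKsucc). exists f. intros x y; apply Hf; auto.
Qed.

Lemma small_below (x : K) : small (fun y => le_of ltK y x).
Proof.
  destruct (proj2 hKsucc x) as [f Hf].
  destruct (infinite_absorbs_nat L hLinf) as [j Hj].
  exists (fun y => match excluded_middle_informative (ltK y x) with
    | left H => j (inr (f (exist _ y H))) | right _ => j (inl 0) end).
  intros y z Hy Hz. repeat destruct (excluded_middle_informative _); intros E;
    apply Hj in E; try discriminate.
  - injection E as E. apply Hf in E. injection E; auto.
  - destruct Hy, Hz; try contradiction. congruence.
Qed.

Lemma small_image {I J} (X : I -> Prop) (g : I -> J) :
  small X -> small (fun j => exists i, X i /\ g i = j).
Proof.
  intros HX.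
  destruct (classic (inhabited I)) as [iI|N].
  2:{ destruct L_inhabited as [l]. exists (fun _ => l).
      intros x y [i _]. destruct N; constructor; exact i. }
  set (r := fun j => epsilon iI (fun i => X i /\ g i = j)).
  assert (Hr : forall j, (exists i, X i /\ g i = j) -> X (r j) /\ g (r j) = j).
  { intros j H. exact (epsilon_spec iI _ H). }
  apply (small_preimage _ X r); auto.
  - intros j H. apply Hr; auto.
  - intros j j' H H' E. rewrite <- (proj2 (Hr j H)), <- (proj2 (Hr j' H')), E. auto.
Qed.

Lemma small_union {I J} (Y : J -> Prop) (X : I -> Prop) (Z : J -> I -> Prop) :
  small Y -> (forall j, Y j -> small (Z j)) ->
  (forall i, X i -> exists j, Y j /\ Z j i) -> small X.
Proof.
  intros HY HZ HX.
  destruct (classic (inhabited J)) as [iJ|N].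
  2:{ destruct L_inhabited as [l]. exists (fun _ => l).
      intros x y Hx. destruct (HX x Hx) as [j _]. destruct N; constructor; exact j. }
  destruct L_inhabited as [l].
  destruct (choice (fun j (f : I -> L) => Y j -> inj_on (Z j) f)) as [f Hf].
  { intros j. destruct (classic (Y j)) as [Yj|NY].
    - destruct (HZ j Yj) as [f Hf]. exists f; auto.
    - exists (fun _ => l). tauto. }
  set (r := fun i => epsilon iJ (fun j => Y j /\ Z j i)).
  assert (Hr : forall i, X i -> Y (r i) /\ Z (r i) i).
  { intros i H. exact (epsilon_spec iJ _ (HX i H)). }
  (* A point is coded by a chosen piece containing it and its code inside that piece. *)
  apply (small_preimage _ (fun z : J * L => Y (fst z) /\ True) (fun i => (r i, f (r i) i))).
  - intros i Xi. simpl. split; auto. apply Hr; auto.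
  - intros i i' Xi Xi' E. injection E as E1 E2. rewrite E1 in E2.
    destruct (Hr i Xi), (Hr i' Xi'). apply (Hf (r i')); auto. rewrite <- E1; auto.
  - apply (small_pair Y (fun _ => True)); auto. apply small_L.
Qed.

(** Regularity of lambda^+: an unbounded image would cover [K] by at most lambda segments of size at
    most lambda. *)
Lemma small_bounded {I} (X : I -> Prop) (F : I -> K) :
  small X -> exists y, forall i, X i -> ltK (F i) y.
Proof.
  intros HX. apply NNPP. intros N. apply K_not_small.
  apply (small_union X _ (fun i y => le_of ltK y (F i)) HX).
  - intros; apply small_below.
  - intros y _. apply NNPP. intros N'. apply N. exists y. intros i Xi.
    destruct (le_of_dec ltK hK (F i) y); auto. exfalso. eauto.
Qed.

Lemma injection_of_not_small {I W} (R : W -> W -> Prop) (Y : I -> Prop) :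
  well_founded R -> (forall x y, R x y \/ x = y \/ R y x) ->
  (forall w, small (fun v => R v w)) -> ~ small Y ->
  exists f : W -> I, (forall w, Y (f w)) /\ injective f.
Proof.
  intros Wf Tot HR HY.
  assert (iI : inhabited I).
  { apply NNPP. intros N. apply HY. destruct L_inhabited as [l].
    exists (fun _ => l). intros x. destruct N; constructor; exact x. }
  destruct (greedy_injection R (fun _ => True) Y Wf Tot iI) as [f [Hf If]].
  - intros w _ g. apply NNPP. intros N. apply HY.
    apply (small_subset _ (fun i => exists v, R v w /\ g v = i));
      [|apply small_image; auto].
    intros i Yi. apply NNPP. intros N'. apply N. exists i. split; auto.
    intros v _ Rv E. eauto.
  - exists f. split; auto. intros x y. apply If; auto.
Qed.

Lemma injection_of_unbounded (Y : K -> Prop) :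
  (forall x, exists y, Y y /\ ltK x y) -> exists f : K -> K, (forall i, Y (f i)) /\ injective f.
Proof.
  intros HY. destruct hK as [W [_ Tot]].
  apply (injection_of_not_small ltK); auto.
  - intros w. apply (small_subset _ _ (fun v H => or_introl H) (small_below w)).
  - intros S. destruct (small_bounded Y (fun y => y) S) as [x Hx].
    destruct (HY x) as [y [Yy Hy]]. apply (le_not_lt ltK hK x y); auto. left; auto.
Qed.

Lemma K_no_max (x : K) : exists y, ltK x y.
Proof.
  destruct (small_bounded _ (fun y => y) (small_below x)) as [y Hy].
  exists y. apply Hy. apply le_of_refl.
Qed.

(** * Closure points, stationary sets and pressing down *)

Definition closed_under (G : K -> K) (d : K) : Prop :=
  forall x, ltK x d -> ltK (G x) d.

Lemma closed_under_unbounded (G : K -> K) (x : K) :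
  exists d, ltK x d /\ closed_under G d.
Proof.
  assert (HN : exists N : K -> K, forall x,
    ltK x (N x) /\ forall y, le_of ltK y x -> ltK (G y) (N x)).
  { apply (choice (fun x z => ltK x z /\ forall y, le_of ltK y x -> ltK (G y) z)).
    intros u. destruct (small_bounded _ G (small_below u)) as [z Hz].
    destruct (upper_bound2 ltK hK u z) as [v [_ [H1 H2]]].
    destruct (K_no_max v) as [w Hw]. exists w. split.
    - eapply le_lt_trans; eauto.
    - intros y Hy. eapply lt_le_trans; eauto. left. eapply le_lt_trans; eauto. }
  destruct HN as [N HN].
  (* The closure point is the supremum of omega iterations of [N], which dominates [G] on whole
     segments. *)
  set (it := fix it n := match n with 0 => x | S n => N (it n) end).
  destruct (least_element ltK hK (fun d => forall n, ltK (it n) d)) as [d [Hd Ld]].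
  { destruct (small_bounded (fun _ : nat => True) it) as [y Hy]; eauto.
    destruct hLinf as [f Hf]. exists f. intros n m _ _; apply Hf. }
  exists d. split. { exact (Hd 0). }
  intros y Hy.
  assert (Hn : exists n, le_of ltK y (it n)).
  { apply NNPP. intros Nn. apply (le_not_lt ltK hK d y); auto. apply Ld. intros n.
    destruct (le_of_dec ltK hK (it n) y); auto. exfalso; eauto. }
  destruct Hn as [n Hn]. destruct hK as [_ [Tr _]].
  eapply Tr; [|exact (Hd (S n))]. apply HN; auto.
Qed.

(* For sets of nonzero ordinals this is equivalent to stationarity, since the
   sets of closure points generate the club filter. *)
Definition stat (S : K -> Prop) : Prop :=
  forall G : K -> K, exists d, S d /\ closed_under G d.

Lemma stationary_stat S : stationary_in ltK (fun _ => True) S -> stat S.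
Proof.
  intros HS G. destruct (HS (closed_under G)) as [d [_ [Sd Cd]]]; eauto.
  split; [split; auto|].
  - intros x _. destruct (closed_under_unbounded G x) as [d [H1 H2]].
    exists d. split; auto. left; auto.
  - intros b _ _ Hb y Hy. destruct (Hb y Hy) as [g [Cg [H1 H2]]].
    destruct hK as [_ [Tr _]]. eapply Tr; [apply Cg|]; eauto.
Qed.

Definition nonzero (d : K) : Prop := exists y, ltK y d.

(** Raising all values of [G] to at least [x] forces every nonzero closure point above [x]; zero is
    a closure point of every function. *)
Lemma stat_above S x : (forall d, S d -> nonzero d) -> stat S ->
  stat (fun d => S d /\ ltK x d).
Proof.
  intros NZ HS G.
  destruct (HS (fun y => epsilon (inhabits x) (fun z => le_of ltK x z /\ le_of ltK (G y) z)))
    as [d [Sd Cd]].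
  assert (H : forall y, ltK y d -> ltK x d /\ ltK (G y) d).
  { intros y Hy. specialize (Cd y Hy). simpl in Cd.
    destruct (epsilon_spec (inhabits x) (fun z => le_of ltK x z /\ le_of ltK (G y) z)).
    - destruct (upper_bound2 ltK hK x (G y)) as [z [_ Hz]]; eauto.
    - split; eapply le_lt_trans; eauto. }
  exists d. repeat split; auto.
  - destruct (NZ d Sd) as [y Hy]. apply (H y Hy).
  - intros y Hy. apply (H y Hy).
Qed.

Lemma stat_unbounded S : (forall d, S d -> nonzero d) -> stat S ->
  forall x, exists d, S d /\ ltK x d.
Proof.
  intros NZ HS x. destruct (stat_above S x NZ HS (fun y => y)) as [d [? _]]; eauto.
Qed.

(** Fodor's lemma, with an additional function into lambda made constant at the same time. *)
Lemma pressing_down (S : K -> Prop) (f : K -> K) (g : K -> L) :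
  stat S -> (forall d, S d -> ltK (f d) d) ->
  exists x l, stat (fun d => S d /\ f d = x /\ g d = l).
Proof.
  intros HS Hf. apply NNPP. intros N.
  destruct (choice (fun (z : K * L) (G : K -> K) => forall d,
     S d -> f d = fst z -> g d = snd z -> ~ closed_under G d)) as [G HG].
  { intros [x l]. apply NNPP. intros N1. apply N. exists x, l. intros G.
    apply NNPP. intros N2. apply N1. exists G. intros d Sd E1 E2 Cd.
    apply N2. exists d. auto. }
  (* Diagonal intersection: [B] dominates all functions [G (a, l)] at once, so a closure point [d]
     of [B] is closed under [G (f d, g d)], as [f d] is below [d]. *)
  destruct (choice (fun x y => forall a b l, le_of ltK a x -> le_of ltK b x ->
     ltK (G (a, l) b) y)) as [B HB].
  { intros x.
    destruct (small_bounded _ (fun z : K * (K * L) => G (fst z, snd (snd z)) (fst (snd z)))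
      (small_pair _ _ (small_below x) (small_pair _ _ (small_below x) small_L))) as [y Hy].
    exists y. intros a b l Ha Hb. apply (Hy (a, (b, l))); simpl; auto. }
  destruct (HS B) as [d [Sd Cd]].
  apply (HG (f d, g d) d Sd eq_refl eq_refl). intros b Hb.
  destruct (upper_bound2 ltK hK (f d) b) as [x [Hx [H1 H2]]].
  destruct hK as [_ [Tr _]]. eapply Tr; [apply (HB x); auto|].
  apply Cd. destruct Hx as [-> | ->]; auto.
Qed.

(** * Local injections, the function [h], and ladders bounded below points of [S] *)

Lemma exists_local_injections :
  exists e : K -> K -> L, forall x, inj_on (fun y => le_of ltK y x) (e x).
Proof. apply (choice (fun x f => inj_on (fun y => le_of ltK y x) f)). apply small_below. Qed.

(* Some row [fun d => e d x] of the array of local injections works: otherwise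
   on a small but [L]-sized set of rows the bounds would coincide, and an
   ordinal [d] closed enough would make [e d] inject [L] into a proper initial
   segment of [L]. *)
Lemma exists_stat_unbounded_function S :
  (forall d, S d -> nonzero d) -> stat S ->
  exists h : K -> L, forall l, stat (fun d => S d /\ ~ ltL (h d) l).
Proof.
  intros NZ HS. destruct exists_local_injections as [e He].
  apply NNPP. intros N.
  destruct (choice (fun x (z : L * (K -> K)) => forall d, S d -> closed_under (snd z) d ->
    ltL (e d x) (fst z))) as [q Hq].
  { intros x. apply NNPP. intros N1. apply N. exists (fun d => e d x). intros l G.
    apply NNPP. intros N2. apply N1. exists (l, G). simpl. intros d Sd Cd.
    apply NNPP. intros N3. eauto. }
  assert (Hl : exists l, ~ small (fun x => fst (q x) = l)).
  { apply NNPP. intros N1. apply K_not_small.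
    apply (small_union (fun _ : L => True) _ (fun l x => fst (q x) = l) small_L); eauto.
    intros l _. apply NNPP. eauto. }
  destruct Hl as [l Hl].
  destruct (injection_of_not_small ltL (fun x => fst (q x) = l)) as [u [Hu Iu]]; auto.
  { apply hL. } { apply hL. }
  { intros w. apply (small_subset _ _ (fun _ _ => I) small_L). }
  destruct (choice (fun x y => forall a i, le_of ltK a x ->
     ltK (snd (q (u i)) a) y /\ ltK (u i) y)) as [B HB].
  { intros x.
    destruct (small_bounded _ (fun z : K * L => snd (q (u (snd z))) (fst z))
      (small_pair _ _ (small_below x) small_L)) as [y Hy].
    destruct (small_bounded _ u small_L) as [y' Hy'].
    destruct (upper_bound2 ltK hK y y') as [z [_ [H1 H2]]].
    exists z. intros a i Ha. split.
    - apply (lt_le_trans ltK hK _ y); auto. apply (Hy (a, i)); simpl; auto.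
    - apply (lt_le_trans ltK hK _ y'); auto. }
  destruct (HS B) as [d [Sd Cd]].
  destruct hK as [_ [Tr _]].
  assert (Hud : forall i, ltK (u i) d).
  { intros i. destruct (NZ d Sd) as [y Hy].
    apply (Tr _ (B y)); auto. apply (HB y y i (le_of_refl ltK y)). }
  assert (Hd : forall i, ltL (e d (u i)) l).
  { intros i. rewrite <- (Hu i). apply Hq; auto. intros a Ha.
    apply (Tr _ (B a)); auto. apply (HB a a i (le_of_refl ltK a)). }
  apply (hLcard l). exists (fun i => exist _ (e d (u i)) (Hd i)).
  intros i j E. injection E as E. apply Iu, (He d); auto; left; auto.
Qed.

(* If [seg g] has countable cofinality, thin a countable cofinal set to the
   points exceeding all points of smaller index: it then has order type at most
   omega. Otherwise take a club in [seg g] avoiding [S]. *)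
Lemma avoiding_ladder (S : K -> Prop) :
  (forall d, S d -> nonzero d) ->
  (forall a, uncountable_cof ltK (seg ltK a) -> ~ stationary_in ltK (seg ltK a) S) ->
  forall g, exists X, cofinal_in ltK (seg ltK g) X /\
    forall d, S d -> ltK d g ->
      exists y, ltK y d /\ forall z, X z -> ltK z d -> le_of ltK z y.
Proof.
  intros NZ HR g. destruct (classic (uncountable_cof ltK (seg ltK g))) as [U|NU].
  - specialize (HR g U). apply not_all_ex_not in HR. destruct HR as [X HX].
    apply imply_to_and in HX. destruct HX as [[Xc Xcl] HX].
    exists X. split; auto. intros d Sd Hd.
    apply NNPP. intros N. apply HX. exists d. repeat split; auto.
    apply Xcl; auto. { apply NZ; auto. }
    intros y Hy. apply NNPP. intros N'. apply N. exists y. split; auto.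
    intros z Xz Hz. destruct (le_of_dec ltK hK y z); auto. exfalso; eauto.
  - apply not_all_ex_not in NU. destruct NU as [X HX].
    apply imply_to_and in HX. destruct HX as [[Xs Xc] HX]. apply NNPP in HX.
    destruct HX as [f0 Hf0].
    assert (Hf : exists f : K -> nat, inj_on X f).
    { exists (fun y => match excluded_middle_informative (X y) with
        | left H => f0 (exist _ y H) | right _ => 0 end).
      intros y z Xy Xz. repeat destruct (excluded_middle_informative _); try contradiction.
      intros E. apply Hf0 in E. injection E; auto. }
    clear f0 Hf0. destruct Hf as [f If].
    exists (fun x => X x /\ forall y, X y -> f y < f x -> ltK y x). split; [split|].
    + intros y [Xy _]; auto.
    + intros x Hx. destruct (Xc x Hx) as [y0 Hy0].
      destruct (least_element Peano.lt
        (conj Wf_nat.lt_wf (conj PeanoNat.Nat.lt_trans PeanoNat.Nat.lt_trichotomy))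
        (fun n => exists y, X y /\ le_of ltK x y /\ f y = n)) as [n [[y [Xy [Hy <-]]] Hn]].
      { exists (f y0), y0. tauto. }
      exists y. repeat split; auto. intros z Xz Hz.
      destruct (le_of_dec ltK hK z x) as [l|l].
      { eapply lt_le_trans; eauto. }
      exfalso. destruct (Hn (f z)) as [?|?]; eauto; lia.
    + intros d Sd Hd. destruct (Xc d Hd) as [y0 [Xy0 Hy0]].
      (* At most one point has index [n], so finitely many indices are bounded below [d] by
         induction. A thinned point below [d] has index less than [f y0], since otherwise it would
         equal or exceed [y0]. *)
      assert (Hn : forall n, exists y, ltK y d /\ forall z,
        (X z /\ forall y, X y -> f y < f z -> ltK y z) -> ltK z d -> f z < n -> le_of ltK z y).
      { induction n as [|n [y [Hy IH]]].
        - destruct (NZ d Sd) as [y Hy]. exists y. split; auto. lia.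
        - destruct (classic (exists z, (X z /\ forall y, X y -> f y < f z -> ltK y z) /\
            ltK z d /\ f z = n)) as [[z [[Xz Rz] [Hz Ez]]]|N].
          + destruct (upper_bound2 ltK hK y z) as [w [Hw [H1 H2]]].
            exists w. split. { destruct Hw as [-> | ->]; auto. }
            intros t Ht Htd Hft. destruct (classic (f t = n)) as [E|E].
            * assert (t = z) as ->; auto. apply If; auto; [apply Ht|congruence].
            * apply (le_le_trans ltK hK _ y); auto. apply IH; auto; lia.
          + exists y. split; auto. intros t Ht Htd Hft. apply IH; auto.
            destruct (classic (f t = n)) as [E|E]; [|lia]. exfalso; eauto. }
      destruct (Hn (f y0)) as [y [Hy Hb]]. exists y. split; auto.
      intros z Xz Hz. apply Hb; auto.
      assert (Hzy : ltK z y0) by (eapply lt_le_trans; eauto).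
      destruct (PeanoNat.Nat.lt_trichotomy (f z) (f y0)) as [?|[E|?]]; auto; exfalso.
      * apply If in E; auto; [|apply Xz]. subst. apply (lt_irr ltK hK _ Hzy).
      * apply (lt_irr ltK hK z). destruct hK as [_ [Tr _]]. eapply Tr; eauto.
        apply Xz; auto.
Qed.

(** * Walks along ladders *)

Section Walks.
Variables (S : K -> Prop) (ladder : K -> K -> Prop) (h : K -> L).
Hypothesis Snz : forall d, S d -> nonzero d.
Hypothesis Hladder : forall g, cofinal_in ltK (seg ltK g) (ladder g).
Hypothesis ladder_S : forall g d, S d -> ltK d g ->
  exists y, ltK y d /\ forall z, ladder g z -> ltK z d -> le_of ltK z y.

Definition next (a b : K) : K :=
  epsilon (inhabits a) (fun g => ladder b g /\ le_of ltK a g /\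
    forall g', ladder b g' -> le_of ltK a g' -> le_of ltK g g').

Lemma next_spec a b : ltK a b -> ladder b (next a b) /\ le_of ltK a (next a b) /\
  forall g', ladder b g' -> le_of ltK a g' -> le_of ltK (next a b) g'.
Proof.
  intros Hab. unfold next. apply epsilon_spec.
  destruct (least_element ltK hK (fun g => ladder b g /\ le_of ltK a g)) as [g [[H1 H2] H3]].
  - destruct (proj2 (Hladder b) a Hab) as [g Hg]. eauto.
  - exists g; auto.
Qed.

Lemma next_lt a b : ltK a b -> ltK (next a b) b.
Proof. intros H. apply (proj1 (Hladder b)), next_spec; auto. Qed.

Lemma next_eq a d b : le_of ltK a d -> ltK d b ->
  (forall z, ladder b z -> ltK z d -> ltK z a) -> next a b = next d b.
Proof.
  intros Had Hdb Hz.
  destruct (next_spec d b Hdb) as [H1 [H2 H3]].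
  destruct (next_spec a b (le_lt_trans ltK hK _ _ _ Had Hdb)) as [H4 [H5 H6]].
  assert (Hd : le_of ltK d (next a b)).
  { destruct (le_of_dec ltK hK (next a b) d) as [l|l]; auto.
    exfalso. apply (le_not_lt ltK hK _ _ H5); auto. }
  pose proof (H3 _ H4 Hd) as E1.
  pose proof (H6 _ H1 (le_le_trans ltK hK _ _ _ Had H2)) as E2.
  destruct E1 as [E1|E1]; auto. exfalso. apply (le_not_lt ltK hK _ _ E2 E1).
Qed.

(* [hits l a b g]: the first point [x] with [~ h x < l] on the walk from [b]
   down to [a] is [g]. *)
Inductive hits (l : L) (a : K) : K -> K -> Prop :=
| hits_here b : ~ ltL (h b) l -> hits l a b b
| hits_later b g : ltL (h b) l -> ltK a b -> hits l a (next a b) g -> hits l a b g.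

Lemma hits_unique l a b g g' : hits l a b g -> hits l a b g' -> g = g'.
Proof.
  intros H. revert g'. induction H as [b Hb|b g Hb Hab H IH]; intros g' H'.
  - inversion H'; subst; auto; contradiction.
  - apply IH. inversion H'; subst; auto; contradiction.
Qed.

Lemma walk_step d b : S d -> ltK d b -> exists y, ltK y d /\
  forall a, ltK y a -> le_of ltK a d -> next a b = next d b.
Proof.
  intros Sd Hd. destruct (ladder_S b d Sd Hd) as [y [Hy Hz]].
  exists y. split; auto. intros a Hya Had. apply next_eq; auto.
  intros z H1 H2. eapply le_lt_trans; eauto.
Qed.

(** By induction on [b]: for [a] close below [d] the walk from [b] to [a] starts with the walk from
    [b] to [d]. The bound [m] dominates [h] on the points visited before [d], so for [l] above [m]
    the search only begins at [d]. *)
Lemma walk_through d b : S d -> le_of ltK d b -> exists y m, ltK y d /\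
  forall l, ltL m l -> forall a, ltK y a -> ltK a d ->
  forall g, hits l a d g -> hits l a b g.
Proof.
  intros Sd. destruct hK as [W [Tr _]].
  induction (W b) as [b _ IH]. intros [Hdb|<-].
  2:{ destruct (Snz d Sd) as [y Hy]. exists y, (h y); auto. }
  destruct (IH (next d b)) as [y1 [m1 [Hy1 H1]]].
  { apply next_lt; auto. }
  { apply next_spec; auto. }
  destruct (walk_step d b Sd Hdb) as [y2 [Hy2 H2]].
  destruct (upper_bound2 ltK hK y1 y2) as [y [Hy [Ly1 Ly2]]].
  destruct (upper_bound2 ltL hL m1 (h b)) as [m [_ [Lm1 Lm2]]].
  exists y, m. split. { destruct Hy as [-> | ->]; auto. }
  intros l Hl a Hya Had g Hg. apply hits_later.
  - eapply le_lt_trans; eauto.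
  - eauto.
  - rewrite H2; [|eapply le_lt_trans; eauto|left; auto].
    apply H1; auto; eapply le_lt_trans; eauto.
Qed.

(** For [a] close below [d] the walk follows the walk to [d], and it stops at [d] at the latest
    because [h d] is not below [l]. *)
Lemma walk_hits d b l : S d -> ~ ltL (h d) l -> le_of ltK d b ->
  exists g y, le_of ltK d g /\ ltK y d /\
    forall a, ltK y a -> ltK a d -> hits l a b g.
Proof.
  intros Sd Hdl. destruct hK as [W [Tr _]].
  induction (W b) as [b _ IH]. intros Hdb.
  destruct (classic (ltL (h b) l)) as [Hb|Hb].
  2:{ destruct (Snz d Sd) as [y Hy]. exists b, y. repeat split; auto.
      intros; apply hits_here; auto. }
  destruct Hdb as [Hdb|<-]; [|contradiction].
  destruct (IH (next d b)) as [g [y1 [Hg [Hy1 H1]]]].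
  { apply next_lt; auto. }
  { apply next_spec; auto. }
  destruct (walk_step d b Sd Hdb) as [y2 [Hy2 H2]].
  destruct (upper_bound2 ltK hK y1 y2) as [y [Hy [Ly1 Ly2]]].
  exists g, y. repeat split; auto. { destruct Hy as [-> | ->]; auto. }
  intros a Hya Had. apply hits_later; eauto.
  rewrite H2; [|eapply le_lt_trans; eauto|left; auto].
  apply H1; auto; eapply le_lt_trans; eauto.
Qed.

(** * Families of pairwise disjoint sets of order type below chi *)

Section Families.
Variables (C : Type) (ltC : C -> C -> Prop).
Hypotheses (hCcard : is_cardinal ltC)
  (hCcf : cof_ge C ltL (fun _ => True)).

(** An unbounded image of [a] would be cofinal, so [C] would inject into it and hence into the
    proper segment below [s], although [C] is a cardinal. *)
Lemma otp_bounded {T} (lt : T -> T -> Prop) (D : T -> Prop) s a (F : K -> T) :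
  well_order lt -> cof_ge C lt D -> has_otp K ltK C ltC s a ->
  (forall x, a x -> D (F x)) -> exists y, D y /\ forall x, a x -> lt (F x) y.
Proof.
  intros wo HD [f [Hf [_ Sf]]] HF. apply NNPP. intros N.
  destruct (HD (fun t => exists x, a x /\ F x = t)) as [u Hu].
  { split.
    - intros t [x [ax <-]]; auto.
    - intros t Dt. apply NNPP. intros N'. apply N. exists t. split; auto.
      intros x ax. destruct (le_of_dec lt wo (F x) t); auto.
      exfalso. apply N'. exists (F x). eauto. }
  apply (hCcard s).
  destruct (choice (fun i xi => F (f xi) = proj1_sig (u i))) as [v Hv].
  { intros i. destruct (u i) as [t [x [ax Ex]]]. destruct (Sf x ax) as [xi <-]. eauto. }
  exists v. intros i j E. apply Hu. pose proof (Hv i) as E1. rewrite E, Hv in E1.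
  apply eq_sig_hprop; auto. intros; apply proof_irrelevance.
Qed.

Lemma otp_small s a : has_otp K ltK C ltC s a -> small a.
Proof.
  intros [f [_ [_ Sf]]].
  apply (small_subset _ (fun x => exists xi, True /\ f xi = x)).
  { intros x ax. destruct (Sf x ax) as [xi Hxi]; eauto. }
  (* Since chi is at most cf(lambda), it is at most lambda: the whole of [L] is cofinal in
     itself. *)
  apply small_image. destruct (hCcf (fun _ => True)) as [u Hu].
  { split; auto. intros x _. exists x; split; auto. apply le_of_refl. }
  exists (fun xi => proj1_sig (u (proj1_sig xi))).
  intros [x Px] [y Py] _ _ E. simpl in E.
  apply eq_sig_hprop; [intros; apply proof_irrelevance|]. apply Hu.
  apply eq_sig_hprop; auto. intros; apply proof_irrelevance.
Qed.

Lemma size_K_not_small (A : (K -> Prop) -> Prop) : size_K K A -> ~ small A.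
Proof.
  intros [[f Hf] _] HA. apply K_not_small.
  apply (small_preimage _ A (fun x => proj1_sig (f x))); auto.
  - intros x _. apply proj2_sig.
  - intros x y _ _ E. apply Hf. apply eq_sig_hprop; auto.
    intros; apply proof_irrelevance.
Qed.

(** An empty member forces [s] to be zero; then all members are empty and the family has at most
    one. *)
Lemma good_family_nonempty s A a :
  good_family K ltK C ltC s A -> A a -> exists x, a x.
Proof.
  intros [HA [_ HK]] Aa. apply NNPP. intros N.
  apply (size_K_not_small A HK). destruct L_inhabited as [l]. exists (fun _ => l).
  assert (E : forall b, A b -> b = fun _ => False).
  { intros b Ab. extensionality x. apply propositional_extensionality.
    split; [|tauto]. intros bx. apply N.
    destruct (HA a Aa) as [f [Hf _]], (HA b Ab) as [g [_ [_ Sg]]].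
    destruct (Sg x bx) as [xi _]. exists (f xi); auto. }
  intros b b' Ab Ab' _. rewrite (E b Ab), (E b' Ab'). auto.
Qed.

(** Otherwise every member has a point at or below [x]; by disjointness these points are distinct,
    so the family would be small. *)
Lemma good_family_above s A x :
  good_family K ltK C ltC s A -> exists a, A a /\ forall y, a y -> ltK x y.
Proof.
  intros [HA [Dj HK]]. apply NNPP. intros N. apply (size_K_not_small A HK).
  destruct (choice (fun a y => A a -> a y /\ le_of ltK y x)) as [f Hf].
  { intros a. apply NNPP. intros N1. apply N. exists a. split.
    - apply NNPP. intros N2. apply N1. exists x. tauto.
    - intros y ay. destruct (le_of_dec ltK hK x y); auto. exfalso; eauto. }
  apply (small_preimage _ (fun y => le_of ltK y x) f); [|..|apply small_below].
  - intros a Aa. apply Hf; auto.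
  - intros a b Aa Ab E. apply NNPP. intros Nab. apply (Dj a b Aa Ab Nab (f a)).
    split; [|rewrite E]; apply Hf; auto.
Qed.

Lemma good_family_bounded s A a :
  good_family K ltK C ltC s A -> A a -> exists y, forall x, a x -> ltK x y.
Proof.
  intros [HA _] Aa. apply (small_bounded a (fun x => x)). eapply otp_small; eauto.
Qed.

(** * The colouring c+ and its decoding *)

Variables (e : K -> K -> L) (code : L * L * L -> L) (c : K -> K -> L).
Hypothesis He : forall x, inj_on (fun y => le_of ltK y x) (e x).
Hypothesis Hcode : injective code.
Hypothesis Scof : forall d, S d -> cof_ge C ltK (seg ltK d).
Hypothesis Sstat : stat S.
Hypothesis Hh : forall l, stat (fun d => S d /\ ~ ltL (h d) l).

(** The bounds on [w] and [x] keep them where [e g] and [e w] are injective, so at most one [x]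
    qualifies. *)
Definition cplus_rel (a b x : K) : Prop :=
  exists g w l, c a b = code (e w x, e g w, l) /\ hits l a b g /\
    le_of ltK w g /\ le_of ltK x w.

Definition cplus (a b : K) : K := epsilon (inhabits a) (cplus_rel a b).

Lemma cplus_eq a b g w l x : c a b = code (e w x, e g w, l) -> hits l a b g ->
  le_of ltK w g -> le_of ltK x w -> cplus a b = x.
Proof.
  intros Hc Hg Hw Hx.
  assert (H : cplus_rel a b (cplus a b)).
  { apply (epsilon_spec (inhabits a) (cplus_rel a b)). exists x, g, w, l; auto. }
  destruct H as [g' [w' [l' [Hc' [Hg' [Hw' Hx']]]]]].
  rewrite Hc in Hc'. apply Hcode in Hc'. injection Hc' as E1 E2 <-.
  rewrite (hits_unique _ _ _ _ _ Hg Hg') in *.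
  apply He in E2; auto. subst w'. apply He in E1; auto.
Qed.

(* The points [d0] make the walks from all elements of a set in [B] meet at a
   single point before the value of [h] has exceeded [l]; so the first point
   where it does exceed [l] is the same for the whole set, and it lies above
   [d], because [h d] itself is large. *)
Lemma cplus_decodes s B w : good_family K ltK C ltC s B ->
  exists l k y0, forall t, exists d b, ltK t d /\ B b /\
    (forall y, b y -> ltK d y) /\
    forall a y x, ltK y0 a -> ltK a d -> b y -> le_of ltK x w ->
      c a y = code (e w x, k, l) -> cplus a y = x.
Proof.
  intros HB. pose proof (fun x y z => proj1 (proj2 hK) x y z) as Tr.
  destruct (choice (fun d b => B b /\ forall y, b y -> ltK d y)) as [bb Hbb].
  { intros d. eapply good_family_above; eauto. }
  (* [f1 d] bounds, over all [y] in [bb d], the two thresholds given by [walk_through]; the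
     cofinality of [d] keeps the first below [d], that of lambda keeps the second in [L]. *)
  destruct (choice (fun d (z : K * L) => S d -> ltK (fst z) d /\
    forall y, bb d y -> forall a, ltK (fst z) a -> ltK a d ->
    forall g, hits (snd z) a d g -> hits (snd z) a y g)) as [f1 Hf1].
  { intros d. destruct (classic (S d)) as [Sd|N].
    2:{ destruct L_inhabited as [l]. exists (d, l). tauto. }
    destruct (choice (fun y (z : K * L) => le_of ltK d y -> ltK (fst z) d /\
      forall l, ltL (snd z) l -> forall a, ltK (fst z) a -> ltK a d ->
      forall g, hits l a d g -> hits l a y g)) as [f Hf].
    { intros y. destruct (classic (le_of ltK d y)) as [Hy|Hy].
      - destruct (walk_through d y Sd Hy) as [z [m H]]. exists (z, m). auto.
      - destruct L_inhabited as [l]. exists (d, l). tauto. }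
    destruct (Hbb d) as [Bd Ad].
    destruct (otp_bounded ltK (seg ltK d) s (bb d) (fun y => fst (f y)) hK (Scof d Sd))
      as [z [Hz Lz]].
    { apply HB; auto. } { intros y Hy. apply Hf. left; auto. }
    destruct (otp_bounded ltL (fun _ => True) s (bb d) (fun y => snd (f y)) hL hCcf)
      as [l [_ Ll]].
    { apply HB; auto. } { auto. }
    exists (z, l). intros _. simpl. split; auto.
    intros y Hy a Ha Had g Hg. apply (Hf y); eauto. left; auto. }
  destruct (pressing_down S (fun d => fst (f1 d)) (fun d => snd (f1 d)) Sstat)
    as [y1 [l S1]].
  { intros d Sd. apply Hf1; auto. }
  set (P1 := fun d => S d /\ fst (f1 d) = y1 /\ snd (f1 d) = l) in *.
  (* [f2 d] consists of a point [d0] of [P1] above [d], the hit point [g] of the walks from [d0],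
     and the bound below [d] beyond which [g] is the same for all [a]. *)
  destruct (choice (fun d (z : K * (K * K)) => S d -> ~ ltL (h d) l ->
    P1 (fst z) /\ ltK d (fst z) /\ le_of ltK d (fst (snd z)) /\ ltK (snd (snd z)) d /\
    forall a, ltK (snd (snd z)) a -> ltK a d -> hits l a (fst z) (fst (snd z))))
    as [f2 Hf2].
  { intros d. destruct (classic (S d /\ ~ ltL (h d) l)) as [[Sd Hd]|N].
    2:{ exists (d, (d, d)). tauto. }
    destruct (stat_unbounded P1 (fun d H => Snz d (proj1 H)) S1 d) as [d0 [Pd0 Hd0]].
    destruct (walk_hits d d0 l Sd Hd (or_introl Hd0)) as [g [y H]].
    exists (d0, (g, y)). simpl. tauto. }
  (* Requiring [d] above [w] puts [w] below [g], where [e g] can decode it. *)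
  destruct (pressing_down (fun d => (S d /\ ~ ltL (h d) l) /\ ltK w d)
    (fun d => snd (snd (f2 d))) (fun d => e (fst (snd (f2 d))) w)) as [y2 [k S2]].
  { apply stat_above; auto. intros d [Sd _]; auto. }
  { intros d [[Sd Hd] _]. apply (Hf2 d Sd Hd). }
  destruct (upper_bound2 ltK hK y1 y2) as [y0 [_ [L1 L2]]].
  exists l, k, y0. intros t.
  edestruct (stat_unbounded _ (fun d H => Snz d (proj1 (proj1 (proj1 H)))) S2 t)
    as [d [[[[Sd Hd] Hwd] [E1 E2]] Htd]].
  destruct (Hf2 d Sd Hd) as [P1d [Hdd0 [Hdg [_ Hhit]]]].
  destruct P1d as [Sd0 [E3 E4]].
  destruct (Hbb (fst (f2 d))) as [Bb Ab].
  exists d, (bb (fst (f2 d))). repeat split; auto.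
  { intros y Hy. eapply Tr; eauto. }
  intros a y x Ha Had Hy Hx Hc.
  apply (cplus_eq a y (fst (snd (f2 d))) w l); auto.
  - rewrite E2; auto.
  - rewrite <- E4. apply (proj2 (Hf1 _ Sd0)); auto.
    + rewrite E3. eapply le_lt_trans; eauto.
    + eapply Tr; eauto.
    + rewrite E4. apply Hhit; auto. rewrite E1. eapply le_lt_trans; eauto.
  - left. eapply lt_le_trans; eauto.
Qed.

(** * Thinning out families *)

Lemma good_subfamily s A (Y : K -> Prop) (F : K -> K -> Prop) :
  good_family K ltK C ltC s A -> (forall x, exists y, Y y /\ ltK x y) ->
  (forall t, Y t -> A (F t)) -> inj_on Y F ->
  good_family K ltK C ltC s (fun a => exists t, Y t /\ F t = a).
Proof.
  intros [HA [Dj [_ [g Hg]]]] HY HF IF.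
  assert (Sub : forall a, (exists t, Y t /\ F t = a) -> A a).
  { intros a [t [Yt <-]]; auto. }
  split; [|split; [|split]]; auto.
  - destruct (injection_of_unbounded Y HY) as [u [Hu Iu]].
    exists (fun i => exist _ (F (u i)) (ex_intro _ (u i) (conj (Hu i) eq_refl))).
    intros i j E. injection E as E. apply Iu, IF; auto.
  - exists (fun z => g (exist _ (proj1_sig z) (Sub _ (proj2_sig z)))).
    intros [a Ha] [b Hb] E. apply Hg in E. injection E as E.
    apply eq_sig_hprop; auto. intros; apply proof_irrelevance.
Qed.

(* [sel] unifies the square case, where it is the identity, with the rectangular
   one, where [sel b] is a member of the other family lying above [b]. *)
Lemma thin_out s A B (sel : (K -> Prop) -> K -> Prop) (Q : K -> (K -> Prop) -> Prop) y0 :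
  good_family K ltK C ltC s A -> good_family K ltK C ltC s B ->
  (forall b, B b -> A (sel b) /\ forall x, sel b x -> exists y, b y /\ le_of ltK y x) ->
  (forall t, exists d b, ltK t d /\ B b /\ (forall y, b y -> ltK d y) /\ Q d b) ->
  exists (Y : K -> Prop) (F : K -> K -> Prop),
    (forall b, (exists t, Y t /\ F t = b) -> B b) /\
    good_family K ltK C ltC s (fun b => exists t, Y t /\ F t = b) /\
    good_family K ltK C ltC s (fun a => exists t, Y t /\ sel (F t) = a) /\
    forall t t', Y t -> Y t' -> set_lt K ltK (sel (F t)) (F t') ->
      exists d, Q d (F t') /\ forall x, sel (F t) x -> ltK y0 x /\ ltK x d.
Proof.
  intros GA GB Hsel HQ. pose proof (fun x y z => proj1 (proj2 hK) x y z) as Tr.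
  destruct (choice (fun t (z : K * (K -> Prop)) => ltK t (fst z) /\ B (snd z) /\
    (forall y, snd z y -> ltK (fst z) y) /\ Q (fst z) (snd z))) as [f Hf].
  { intros t. destruct (HQ t) as [d [b H]]. exists (d, b); auto. }
  destruct (choice (fun t z => forall x, snd (f t) x \/ sel (snd (f t)) x -> ltK x z))
    as [N HN].
  { intros t. destruct (Hf t) as [_ [Bt _]].
    destruct (good_family_bounded s B _ GB Bt) as [z1 H1].
    destruct (good_family_bounded s A _ GA (proj1 (Hsel _ Bt))) as [z2 H2].
    destruct (upper_bound2 ltK hK z1 z2) as [z [_ [L1 L2]]].
    exists z. intros x [Hx|Hx]; [apply (lt_le_trans ltK hK _ z1)|
      apply (lt_le_trans ltK hK _ z2)]; auto. }
  assert (Above : forall t x, sel (snd (f t)) x -> ltK t x).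
  { intros t x Hx. destruct (Hf t) as [H1 [Bt [H2 _]]].
    destruct (proj2 (Hsel _ Bt) x Hx) as [y [Hy Hyx]].
    apply (lt_le_trans ltK hK _ y); eauto. }
  (* [N t] bounds the sets attached to [t], so at closure points of [N] the sets attached to
     different indices are separated by the indices. *)
  set (Y := fun t => ltK y0 t /\ closed_under N t).
  assert (HY : forall x, exists y, Y y /\ ltK x y).
  { intros x. destruct (upper_bound2 ltK hK x y0) as [z [_ [L1 L2]]].
    destruct (closed_under_unbounded N z) as [d [H1 H2]].
    exists d. repeat split; auto; eapply le_lt_trans; eauto. }
  assert (Sep : forall t t', Y t -> Y t' -> ltK t t' -> forall x,
    snd (f t) x \/ sel (snd (f t)) x -> ltK x t').
  { intros t t' Yt [_ Ct'] Htt' x Hx. eapply Tr; eauto. }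
  assert (Inj : forall G : K -> K -> Prop, (forall t x, G t x -> ltK t x) ->
    (forall t x, G t x -> snd (f t) x \/ sel (snd (f t)) x) ->
    (forall t, exists x, G t x) -> inj_on Y G).
  { intros G G1 G2 G3 t t' Yt Yt' E. destruct (proj2 (proj2 hK) t t') as [l|[|l]]; auto;
      exfalso.
    - destruct (G3 t) as [x Hx]. apply (lt_irr ltK hK x).
      apply (Tr _ t'); [apply (Sep t t'); auto|]. apply G1. rewrite <- E; auto.
    - destruct (G3 t') as [x Hx]. apply (lt_irr ltK hK x).
      apply (Tr _ t); [apply (Sep t' t); auto|]. apply G1. rewrite E; auto. }
  exists Y, (fun t => snd (f t)). split; [|split; [|split]].
  - intros b [t [_ <-]]. apply Hf.
  - apply (good_subfamily s B Y (fun t => snd (f t))); auto.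
    + intros t _. apply Hf.
    + apply Inj; auto.
      * intros t x Hx. apply (Tr _ (fst (f t))); apply Hf; auto.
      * intros t. eapply good_family_nonempty; eauto. apply Hf.
  - apply (good_subfamily s A Y (fun t => sel (snd (f t)))); auto.
    + intros t _. apply Hsel, Hf.
    + apply Inj; auto. intros t. apply (good_family_nonempty s A); auto. apply Hsel, Hf.
  - intros t t' Yt Yt' Hlt.
    assert (Bt : B (snd (f t))) by apply Hf.
    assert (Bt' : B (snd (f t'))) by apply Hf.
    destruct (good_family_nonempty s A _ GA (proj1 (Hsel _ Bt))) as [x Hx].
    destruct (good_family_nonempty s B _ GB Bt') as [y Hy].
    (* Only [t] below [t'] is compatible with [Hlt]; then [sel (F t)] lies below [t'], hence below
       the point [d] chosen for [t']. *)
    destruct (proj2 (proj2 hK) t t') as [l|[<-|l]].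
    + exists (fst (f t')). split; [apply Hf|]. intros z Hz. split.
      * apply (Tr _ t); [apply Yt|auto].
      * apply (Tr _ t'); [apply (Sep t t'); auto|apply Hf].
    + exfalso. destruct (proj2 (Hsel _ Bt) x Hx) as [y' [Hy' Hyx]].
      apply (le_not_lt ltK hK _ _ Hyx). auto.
    + exfalso. apply (lt_irr ltK hK x). apply (Tr _ y); auto.
      apply (Tr _ t); [apply (Sep t' t); auto|auto].
Qed.

(** * Transfer of the two relations from [c] to c+ *)

Lemma cplus_pr1 M (p : K -> K -> M) : (exists f : M -> L, injective f) ->
  pr1 K ltK C ltC L c M p -> pr1 K ltK C ltC K cplus M p.
Proof.
  intros [i Hi] Hc s A GA tau.
  destruct (small_bounded (fun _ : M => True) tau) as [w Hw].
  { exists i. intros x y _ _; apply Hi. }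
  destruct (cplus_decodes s A w GA) as [l [k [y0 HQ]]].
  assert (Hsel : forall b, A b -> A b /\ forall x, b x -> exists y, b y /\ le_of ltK y x).
  { intros b Ab. split; auto. intros x Hx. exists x; split; auto. apply le_of_refl. }
  destruct (thin_out s A A (fun b => b) _ y0 GA GA Hsel HQ) as [Y [F [Sub [GF [_ HF]]]]].
  (* [c] is asked to realise the codes of the values of [tau], with [k] and [l] fixed in advance by
     [cplus_decodes]. *)
  destruct (Hc s _ GF (fun j => code (e w (tau j), k, l)))
    as [a [b [[t [Yt <-]] [[t' [Yt' <-]] [Hab E]]]]].
  exists (F t), (F t'). split; [|split; [|split]]; eauto.
  intros x y Hx Hy. destruct (HF t t' Yt Yt' Hab) as [d [Q Hd]].
  destruct (Hd x Hx). apply Q; auto. left; auto.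
Qed.

Lemma cplus_pr1_circ M (p : K -> K -> M) : (exists f : M -> L, injective f) ->
  pr1_circ K ltK C ltC L c M p -> pr1_circ K ltK C ltC K cplus M p.
Proof.
  intros [i Hi] Hc s A B GA GB. exists A. split; [|split]; auto. { apply GA. }
  intros tau. destruct (small_bounded (fun _ : M => True) tau) as [w Hw].
  { exists i. intros x y _ _; apply Hi. }
  destruct (cplus_decodes s B w GB) as [l [k [y0 HQ]]].
  (* [sel b] is a member of [A] above all of [b]; outside [B] its value is arbitrary. *)
  destruct (choice (fun b a => B b -> A a /\ forall x, a x -> exists y, b y /\ le_of ltK y x))
    as [sel Hsel].
  { intros b. destruct (classic (B b)) as [Bb|Nb]; [|exists b; tauto].
    destruct (good_family_bounded s B b GB Bb) as [z Hz].
    destruct (good_family_nonempty s B b GB Bb) as [y Hy].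
    destruct (good_family_above s A z GA) as [a [Aa Ha]].
    exists a. intros _. split; auto. intros x Hx. exists y. split; auto.
    left. apply (proj1 (proj2 hK) y z); auto. }
  destruct (thin_out s A B sel _ y0 GA GB Hsel HQ) as [Y [F [Sub [GF [GS HF]]]]].
  destruct (Hc s _ _ GS GF) as [A' [SA' [_ H]]].
  destruct (H (fun j => code (e w (tau j), k, l))) as [a [b [Aa [[t' [Yt' <-]] [Hab E]]]]].
  destruct (SA' a Aa) as [t [Yt <-]].
  exists (sel (F t)), (F t'). split; [|split; [|split]]; eauto.
  { apply Hsel; eauto. }
  intros x y Hx Hy. destruct (HF t t' Yt Yt' Hab) as [d [Q Hd]].
  destruct (Hd x Hx). apply Q; auto. left; auto.
Qed.

End Families.
End Walks.
End SuccessorCardinal.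

(* lambda = order type of (L, ltL); lambda^+ = order type of (K, ltK);
   chi = order type of (C, ltC). *)
Theorem theorem3p5
  (L : Type) (ltL : L -> L -> Prop)
  (K : Type) (ltK : K -> K -> Prop)
  (C : Type) (ltC : C -> C -> Prop)
  (hL : well_order ltL) (hLcard : is_cardinal ltL) (hLinf : infinite L)
  (hK : well_order ltK) (hKsucc : is_successor_of L ltK)
  (hC : well_order ltC) (hCcard : is_cardinal ltC)
  (hCcf : cof_ge C ltL (fun _ => True))
  (hS : exists S : K -> Prop, nonreflecting_stationary_in_E C ltK S) :
  forall c : K -> K -> L, exists cplus : K -> K -> K,
    forall (M : Type), (exists f : M -> L, injective f) ->
    forall p : K -> K -> M,
      (pr1 K ltK C ltC L c M p -> pr1 K ltK C ltC K cplus M p) /\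
      (pr1_circ K ltK C ltC L c M p -> pr1_circ K ltK C ltC K cplus M p).
Proof.
  intros c. destruct hS as [S [Scof [Sst Snr]]].
  destruct (classic (inhabited C)) as [[c0]|NC].
  (* For chi zero there is no order type [s], and every colouring satisfies both conclusions. *)
  2:{ exists (fun x _ => x). intros M _ p.
      split; intros _ s; destruct NC; constructor; exact s. }
  assert (Snz : forall d, S d -> nonzero K ltK d).
  (* If [d] were zero, the empty set would be cofinal below it and the nonempty [C] would inject
     into it. *)
  { intros d Sd. apply NNPP. intros N. destruct (Scof d Sd (fun _ => False)) as [f _].
    - split; [tauto|]. intros x Hx. exfalso. apply N. exists x. exact Hx.
    - destruct (f c0) as [y []]. }
  pose proof (stationary_stat L ltL K ltK hL hLinf hK hKsucc S Sst) as Sstat.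
  destruct (exists_local_injections L K ltK hLinf hKsucc) as [e He].
  destruct (exists_stat_unbounded_function L ltL K ltK hL hLcard hLinf hK hKsucc S Snz Sstat)
    as [h Hh].
  destruct (choice _ (avoiding_ladder K ltK hK S Snz Snr)) as [ladder Hladder].
  destruct (infinite_square L ltL hL hLinf) as [q Hq].
  assert (Hcode : injective (fun z : L * L * L => q (q (fst z), snd z))).
  { intros [[x y] z] [[x' y'] z'] E. apply Hq in E. injection E as E ->.
    apply Hq in E. injection E as -> ->. reflexivity. }
  exists (cplus L ltL K ltK ladder h e (fun z => q (q (fst z), snd z)) c). intros M HM p. split.
  - apply cplus_pr1 with (S := S); auto; intros; apply Hladder; auto.
  - apply cplus_pr1_circ with (S := S); auto; intros; apply Hladder; auto.
Qed.
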